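(* Let $\mathcal{A}$ be a unital $C^*$-algebra with unit $e$ and let $a,b,x,y\in \mathcal{A}$. Then (for each choice of sign $\pm$) $$v(axb\pm bya)\leq \sqrt{2}\, \min \left\{ \|b\| \sqrt{\|a^*a+aa^*\|},\ \|a\| \sqrt{\|b^*b+bb^*\|} \right\} \max\{ \|x\|, \|y\|\}.$$ In particular, for $x=y=e$, $$v(ab\pm ba)\leq \sqrt{2}\, \min \left\{ \|b\| \sqrt{\|a^*a+aa^*\|},\ \|a\| \sqrt{\|b^*b+bb^*\|} \right\}.$$ In particular, for $x=e$ and $y=0$, $$v(ab)\leq \sqrt{2}\, \min \left\{\|b\| \sqrt{\|a^*a+aa^*\|},\ \|a\| \sqrt{\|b^*b+bb^*\|} \right\}.$$ In particular, if $ab=ba$, then $$v(ab)\leq \frac1{\sqrt{2}} \min \left\{ \|b\| \sqrt{\|a^*a+aa^*\|},\ \|a\| \sqrt{\|b^*b+bb^*\|} \right\}.$$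
   Context: $\mathcal{A}$ is a unital $C^*$-algebra with unit $e$. $S(\mathcal{A})$ is the set of normalized states, i.e. continuous linear functionals $f$ on $\mathcal{A}$ with $f(e)=\|f\|=1$. The algebraic numerical radius of $a$ is $v(a)=\sup\{|f(a)|: f\in S(\mathcal{A})\}$. *)

(* Defs.v *)
From HB Require Import structures.
From mathcomp Require Import all_boot all_order all_algebra.
From mathcomp Require Import all_classical all_reals all_analysis.
From mathcomp Require Import complex.

Set Implicit Arguments.
Unset Strict Implicit.
Unset Printing Implicit Defensive.

Import Order.TTheory GRing.Theory Num.Theory.
Import numFieldNormedType.Exports.

Local Open Scope classical_set_scope.
Local Open Scope ring_scope.

(* A unital complex C*-algebra. Hierarchy-Builder rejects a structure joining
   CompleteNormedModule and GRing.Algebra (NumDomain, declared earlier, already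
   inherits from both a ring and a norm), so the algebra operations are fields
   over a complete normed module, and the library's algType structure is put on
   the carrier afterwards. *)
Record cstarAlg (R : realType) := CStarAlg {
  cstar_car : completeNormedModType R[i] ;
  cstar_one : cstar_car ;
  cstar_mul : cstar_car -> cstar_car -> cstar_car ;
  cstar_star : cstar_car -> cstar_car ;
  cstar_mulA : associative cstar_mul ;
  cstar_mul1r : left_id cstar_one cstar_mul ;
  cstar_mulr1 : right_id cstar_one cstar_mul ;
  cstar_mulDl : left_distributive cstar_mul +%R ;
  cstar_mulDr : right_distributive cstar_mul +%R ;
  cstar_scaleAl : forall (z : R[i]) a b,
    z *: cstar_mul a b = cstar_mul (z *: a) b ;
  cstar_scaleAr : forall (z : R[i]) a b,
    z *: cstar_mul a b = cstar_mul a (z *: b) ;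
  cstar_one_neq0 : cstar_one != 0 ;
  cstar_normM : forall a b, `|cstar_mul a b| <= `|a| * `|b| ;
  cstar_starK : involutive cstar_star ;
  cstar_starD : {morph cstar_star : a b / a + b} ;
  cstar_starZ : forall (z : R[i]) a, cstar_star (z *: a) = z^* *: cstar_star a ;
  cstar_starM : forall a b,
    cstar_star (cstar_mul a b) = cstar_mul (cstar_star b) (cstar_star a) ;
  cstar_norm : forall a, `|cstar_mul (cstar_star a) a| = `|a| ^+ 2
}.

Definition cstar_sort (R : realType) (A : cstarAlg R) : Type := cstar_car A.
Coercion cstar_sort : cstarAlg >-> Sortclass.

Section CStarAlgebraStructures.
Context (R : realType) (A : cstarAlg R).

HB.instance Definition _ :=
  CompleteNormedModule.copy (cstar_sort A) (cstar_car A).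

HB.instance Definition _ := GRing.Zmodule_isNzRing.Build (cstar_sort A)
  (@cstar_mulA R A) (@cstar_mul1r R A) (@cstar_mulr1 R A)
  (@cstar_mulDl R A) (@cstar_mulDr R A) (@cstar_one_neq0 R A).

HB.instance Definition _ := GRing.Lmodule_isLalgebra.Build R[i] (cstar_sort A)
  (@cstar_scaleAl R A).

HB.instance Definition _ := GRing.Lalgebra_isAlgebra.Build R[i] (cstar_sort A)
  (@cstar_scaleAr R A).

End CStarAlgebraStructures.

Definition star (R : realType) (A : cstarAlg R) (a : A) : A := cstar_star a.

(* Norms of normed modules over R[i] are nonnegative elements of R[i]; [rnorm]
   is the same number seen in R, where suprema and square roots live. *)
Definition rnorm (R : realType) (V : normedModType R[i]) (x : V) : R :=
  complex.Re `|x|.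

(* The norm of f when f is continuous; otherwise the supremum is infinite and
   [sup] returns a default value. *)
Definition opnorm (R : realType) (V : normedModType R[i])
    (f : {linear V -> R[i]^o}) : R :=
  sup [set rnorm (f x) | x in [set x : V | rnorm x <= 1]].

Definition states (R : realType) (A : cstarAlg R) :
    set {linear A -> R[i]^o} :=
  [set f : {linear A -> R[i]^o} | [/\ continuous f, f 1 = 1 & opnorm f = 1]].
Arguments states {R} A _.

Definition numradius (R : realType) (A : cstarAlg R) (a : A) : R :=
  sup [set rnorm (f a) | f in states A].

(* Main.v *)
(** A state [f] satisfies the Cauchy-Schwarz inequality
    [|f (u v)|^2 <= f (u u^* ) f (v^* v)].  Splitting [a x b] as [a . (x b)] and
    [b y a] as [(b y) . a] bounds [|f (a x b + b y a)|] by
    [||b|| max(||x||, ||y||) (f (a a^* )^(1/2) + f (a^* a)^(1/2))], and the last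
    factor is at most [(2 f (a^* a + a a^* ))^(1/2)].  A sign or a phase is
    absorbed in [x] and [y]; exchanging the roles of [a] and [b] gives the other
    bound; if [a b = b a], take [x = y = 1/2].

    The substance is [f (c^* c) >= 0], where a state is only known to satisfy
    [f 1 = ||f|| = 1].  As [f 1 = ||f||], it suffices that
    [||1 - c^* c|| <= 1] for [||c|| < 1].  Square roots of [t - h] with
    [||h|| < t] come from a contraction, and replace the functional calculus.
    With [w = 1 - c^* c = e^2] and [x = c e^n], the element
    [1 - x^* x = 1 - w^n + w^(n+1)] is positive, and a quantitative form of
    Kaplansky's argument bounds [||x||^2 = ||w^n - w^(n+1)||] independently of
    [n].  So [||w^n||] grows at most linearly, whence [||w|| <= 1]. *)

Require Import Defs.
From HB Require Import structures.
From mathcomp Require Import all_boot all_order all_algebra.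
From mathcomp Require Import all_classical all_reals all_analysis.
From mathcomp Require Import complex.
From mathcomp Require Import ring lra.
From Stdlib Require Ncring Ncring_tac.

Set Implicit Arguments.
Unset Strict Implicit.
Unset Printing Implicit Defensive.

Import Order.TTheory GRing.Theory Num.Theory.
Import numFieldNormedType.Exports.

Local Open Scope classical_set_scope.
Local Open Scope ring_scope.

(** * Noncommutative ring identities by reflection *)

Section NoncommutativeRing.
Variable T : nzRingType.

#[global] Instance ncring_ops :
  @Ncring.Ring_ops T 0 1 +%R *%R (fun x y => x - y) -%R (@eq T) := {}.

#[global] Instance ncring_ring : Ncring.Ring (Ro := ncring_ops).
Proof.
split; cbn.
- by split; [by []|move=> ? ? ->|move=> ? ? ? -> ->].
- by move=> ? ? -> ? ? ->.
- by move=> ? ? -> ? ? ->.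
- by move=> ? ? -> ? ? ->.
- by move=> ? ? ->.
- exact: add0r.
- exact: addrC.
- exact: addrA.
- exact: mul1r.
- exact: mulr1.
- exact: mulrA.
- exact: mulrDl.
- by move=> ? ? ?; exact: mulrDr.
- by [].
- exact: subrr.
Qed.

End NoncommutativeRing.

Ltac ncring := Ncring_tac.non_commutative_ring.

(** * Norms as real numbers *)

Section RealNorm.
Context (R : realType).

Section NormedModule.
Context (V : normedModType R[i]).
Implicit Types x y : V.

Lemma normr_rnorm x : `|x| = (rnorm x)%:C%C.
Proof. by rewrite /rnorm RRe_real // normr_real. Qed.

Lemma rnorm_ge0 x : 0 <= rnorm x.
Proof. by rewrite -ler0c -normr_rnorm. Qed.

Lemma rnorm0_eq0 x : rnorm x = 0 -> x = 0.
Proof. by move=> x0; apply/eqP; rewrite -normr_eq0 normr_rnorm x0. Qed.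

Lemma rnorm0 : rnorm (0 : V) = 0.
Proof. by rewrite /rnorm normr0. Qed.

Lemma rnormD x y : rnorm (x + y) <= rnorm x + rnorm y.
Proof. by rewrite -lecR rmorphD /= -!normr_rnorm ler_normD. Qed.

Lemma rnormN x : rnorm (- x) = rnorm x.
Proof. by rewrite /rnorm normrN. Qed.

Lemma rnormB x y : rnorm (x - y) <= rnorm x + rnorm y.
Proof. by rewrite -(rnormN y) rnormD. Qed.

Lemma rnormZ (z : R[i]) x : rnorm (z *: x) = complex.Re `|z| * rnorm x.
Proof.
apply: complexI; rewrite rmorphM /= -(normr_rnorm x) -(normr_rnorm (z *: x)).
by rewrite normrZ.
Qed.

End NormedModule.

End RealNorm.

(** * The norm, the involution and the real scalars of a C*-algebra *)

Section CStarNorm.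
Context (R : realType) (A : cstarAlg R).
Implicit Types (a b c d e h k p q u v w x y : A) (s t : R).

(** Real scalars live inside [A], so that mixed identities become ring identities for [ncring]. *)
Definition rscal t : A := (t%:C%C)%:A.

Lemma starK a : star (star a) = a. Proof. exact: cstar_starK. Qed.

Lemma starD a b : star (a + b) = star a + star b.
Proof. exact: cstar_starD. Qed.

Lemma starM a b : star (a * b) = star b * star a.
Proof. exact: cstar_starM. Qed.

Lemma starZ (z : R[i]) a : star (z *: a) = z^* *: star a.
Proof. exact: cstar_starZ. Qed.

Lemma starN a : star (- a) = - star a.
Proof. by rewrite -scaleN1r starZ rmorphN1 scaleN1r. Qed.

Lemma starB a b : star (a - b) = star a - star b.
Proof. by rewrite starD starN. Qed.

Lemma star1 : star (1 : A) = 1.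
Proof. by rewrite -[LHS]mul1r -[X in X * _]starK -starM mul1r starK. Qed.

Lemma star_rscal t : star (rscal t) = rscal t.
Proof.
by rewrite /rscal starZ star1 conj_Creal // complex_real.
Qed.

Lemma starX a n : star (a ^+ n) = star a ^+ n.
Proof.
elim: n => [|n IHn]; first by rewrite !expr0 star1.
by rewrite exprS exprSr starM IHn.
Qed.

Lemma rscalD s t : rscal (s + t) = rscal s + rscal t.
Proof. by rewrite /rscal rmorphD scalerDl. Qed.

Lemma rscalN t : rscal (- t) = - rscal t.
Proof. by rewrite /rscal rmorphN scaleNr. Qed.

Lemma rscalB s t : rscal (s - t) = rscal s - rscal t.
Proof. by rewrite rscalD rscalN. Qed.

Lemma rscalM s t : rscal (s * t) = rscal s * rscal t.
Proof. by rewrite /rscal rmorphM -scalerAl mul1r scalerA. Qed.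

Lemma rscal0 : rscal 0 = 0.
Proof. by rewrite /rscal rmorph0 scale0r. Qed.

Lemma rscal1 : rscal 1 = 1.
Proof. by rewrite /rscal rmorph1 scale1r. Qed.

Lemma rscalE t a : rscal t * a = t%:C%C *: a.
Proof. by rewrite /rscal -scalerAl mul1r. Qed.

Lemma rscalC t a : rscal t * a = a * rscal t.
Proof. by rewrite rscalE /rscal -scalerAr mulr1. Qed.

Lemma rnormM a b : rnorm (a * b) <= rnorm a * rnorm b.
Proof. by rewrite -lecR rmorphM /= -!normr_rnorm; exact: cstar_normM. Qed.

Lemma rnorm_starM a : rnorm (star a * a) = rnorm a ^+ 2.
Proof.
apply: complexI; rewrite rmorphXn /= -!normr_rnorm.
exact: cstar_norm.
Qed.

(** Cancel [rnorm b] in [rnorm b ^+ 2 <= rnorm (star b) * rnorm b], for [b = a] and [b = star a]. *)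
Lemma rnorm_star a : rnorm (star a) = rnorm a.
Proof.
suff le_star b : rnorm b <= rnorm (star b).
  by apply/eqP; rewrite eq_le le_star -{2}(starK a) le_star.
have [b0|b_neq0] := eqVneq (rnorm b) 0; first by rewrite b0 rnorm_ge0.
have b_gt0 : 0 < rnorm b by rewrite lt_def b_neq0 rnorm_ge0.
by rewrite -(ler_pM2r b_gt0) -expr2 -rnorm_starM rnormM.
Qed.

Lemma rnorm_Mstar a : rnorm (a * star a) = rnorm a ^+ 2.
Proof. by rewrite -{1}(starK a) rnorm_starM rnorm_star. Qed.

Lemma rnorm_sq d : star d = d -> rnorm (d * d) = rnorm d ^+ 2.
Proof. by move=> d_sa; rewrite -{1}d_sa rnorm_starM. Qed.

Lemma rnorm1 : rnorm (1 : A) = 1.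
Proof.
have one_neq0 : rnorm (1 : A) != 0.
  by apply/eqP => /rnorm0_eq0/eqP; rewrite oner_eq0.
apply: (mulfI one_neq0); rewrite mulr1 -expr2.
by rewrite -rnorm_starM star1 mul1r.
Qed.

Lemma rnorm_rscalM t a : rnorm (rscal t * a) = `|t| * rnorm a.
Proof. by rewrite rscalE rnormZ normc_def /= expr0n addr0 sqrtr_sqr. Qed.

Lemma rnorm_rscal t : rnorm (rscal t) = `|t|.
Proof. by rewrite -[rscal t]mulr1 rnorm_rscalM rnorm1 mulr1. Qed.

End CStarNorm.

(** Provides the limit of the fixed point iteration for square roots. *)
Lemma geometric_steps_cvg (R : realType) (V : completeNormedModType R[i])
    (u : nat -> V) (c r : R) :
    0 <= r -> r < 1 -> (forall n, rnorm (u n.+1 - u n) <= c * r ^+ n) ->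
  exists l : V, forall eps : R, 0 < eps ->
    exists N : nat, forall n : nat, (N <= n)%N -> rnorm (u n - l) < eps.
Proof.
move=> r_ge0 r_lt1 u_step.
have r1_gt0 : 0 < 1 - r by rewrite subr_gt0.
have c_ge0 : 0 <= c.
  by have := le_trans (rnorm_ge0 _) (u_step 0%N); rewrite expr0 mulr1.
have u_dist n m : rnorm (u (n + m)%N - u n) <= c * r ^+ n / (1 - r).
  have crn : 0 <= c * r ^+ n by rewrite mulr_ge0 // exprn_ge0.
  rewrite ler_pdivlMr //.
  (* The induction needs the exact geometric partial sum. *)
  suff : rnorm (u (n + m)%N - u n) * (1 - r) <= c * r ^+ n * (1 - r ^+ m).
    move=> /le_trans; apply; rewrite ler_piMr // gerBl exprn_ge0 //.
  elim: m => [|m IHm]; first by rewrite addn0 !subrr rnorm0 mul0r mulr0.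
  have -> : u (n + m.+1)%N - u n = (u (n + m).+1 - u (n + m)%N) +
      (u (n + m)%N - u n) by rewrite addrA subrK addnS.
  apply: (le_trans (ler_wpM2r (ltW r1_gt0) (rnormD _ _))).
  rewrite mulrDl; apply: (le_trans (lerD (ler_wpM2r (ltW r1_gt0)
    (u_step _)) IHm)).
  by rewrite exprD exprSr; lra.
have u_small eps : 0 < eps -> exists N, forall n, (N <= n)%N ->
    c * r ^+ n / (1 - r) < eps.
  move=> eps_gt0.
  have rr : `|r| < 1 by rewrite ger0_norm.
  have c1_gt0 : 0 < c + 1 by rewrite ltr_wpDl.
  have /cvgr0Pnorm_lt/(_ (eps * (1 - r) / (c + 1))) := cvg_expr rr.
  case=> [|N _ rN]; first by rewrite divr_gt0 // mulr_gt0.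
  exists N => n /rN /=; rewrite ger0_norm ?exprn_ge0 // ltr_pdivlMr // => rn.
  rewrite ltr_pdivrMr //; apply: le_lt_trans rn.
  by rewrite mulrC ler_wpM2l ?exprn_ge0 // lerDl.
have /cauchy_cvgP u_cvg : cauchy (u @ \oo).
  apply: cauchy_exP => e e_gt0.
  have [e' e'_gt0 ->] : exists2 e' : R, 0 < e' & e = e'%:C%C.
    exists (complex.Re e); last by rewrite RRe_real // gtr0_real.
    by move: e_gt0; rewrite ltcE => /andP[].
  have [N uN] := u_small _ e'_gt0; exists (u N); exists N => // n /= Nn.
  rewrite -ball_normE /= distrC normr_rnorm ltcR.
  by rewrite -(subnKC Nn) (le_lt_trans (u_dist _ _)) // uN.
exists (lim (u @ \oo)) => eps eps_gt0.
have /cvgrPdist_lt/(_ eps%:C%C) : u @ \oo --> lim (u @ \oo) by [].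
case=> [|N _ uN]; first by rewrite ltcR.
exists N => n /uN /=.
by rewrite distrC normr_rnorm ltcR.
Qed.

(** * Square roots and positive elements *)

Section SquareRootsAndPositivity.
Context (R : realType) (A : cstarAlg R).
Implicit Types (a b c d e h k p q u v w x y : A) (s t : R).

(** The factor [t] absorbs the constants of limit arguments. *)
Lemma rnorm_small_eq0 a t :
  (forall eps : R, 0 < eps -> rnorm a <= t * eps) -> a = 0.
Proof.
move=> a_le; apply: rnorm0_eq0; apply/eqP; rewrite eq_le rnorm_ge0 andbT.
apply/ler_addgt0Pr => eps eps_gt0; rewrite add0r.
have t1_gt0 : 0 < `|t| + 1 by rewrite ltr_wpDl.
apply: le_trans (a_le _ (divr_gt0 eps_gt0 t1_gt0)) _.
rewrite mulrA ler_pdivrMr // mulrC ler_pM2l //.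
by rewrite ler_wpDr // ler_norm.
Qed.

(* With [e = 1 - y], the equation [e * e = 1 - h] becomes the fixed point
   equation [y = (h + y * y) / 2], contracting on the ball of radius
   [rnorm h]. *)
Lemma sqrt_one_sub h : star h = h -> rnorm h < 1 ->
  exists e, [/\ star e = e, e * e = 1 - h &
                forall d, d * h = h * d -> d * e = e * d].
Proof.
move=> h_sa; set r := rnorm h => r_lt1.
have r_ge0 : 0 <= r := rnorm_ge0 h.
pose g y := rscal A 2^-1 * (h + y * y).
pose u n := iter n g 0.
have half_ge0 : 0 <= 2^-1 :> R by rewrite invr_ge0.
have g_norm y : rnorm y <= r -> rnorm (g y) <= r.
  move=> y_le; rewrite rnorm_rscalM ger0_norm // ler_pdivrMl //.
  have := rnormD h (y * y); have := rnormM y y; have := rnorm_ge0 y.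
  have : rnorm y * rnorm y <= 1 * r.
    by apply: ler_pM; rewrite ?rnorm_ge0 // (le_trans y_le) // ltW.
  rewrite -/r; lra.
have g_lip y z : rnorm y <= r -> rnorm z <= r ->
    rnorm (g y - g z) <= r * rnorm (y - z).
  move=> y_le z_le; rewrite /g -mulrBr rnorm_rscalM ger0_norm // ler_pdivrMl //.
  have -> : h + y * y - (h + z * z) = y * (y - z) + (y - z) * z by ncring.
  apply: (le_trans (rnormD _ _)); rewrite mulr_natl mulr2n -mulrDl.
  have := rnormM y (y - z); have := rnormM (y - z) z.
  have := ler_wpM2r (rnorm_ge0 (y - z)) y_le.
  have := ler_wpM2r (rnorm_ge0 (y - z)) z_le.
  lra.
have u_norm n : rnorm (u n) <= r.
  by elim: n => [|n IHn]; [rewrite rnorm0|exact: g_norm].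
have u_sa n : star (u n) = u n.
  elim: n => [|n IHn]; first by rewrite /u /= -(rscal0 A) star_rscal.
  by rewrite [u _]/= /g starM starD starM star_rscal -/(u n) IHn h_sa -rscalC.
have u_comm n d : d * h = h * d -> d * u n = u n * d.
  move=> dh; elim: n => [|n IHn]; first by rewrite /u /= mulr0 mul0r.
  rewrite [u _]/= /g -/(u n) mulrA -rscalC -!mulrA; congr (_ * _).
  by rewrite mulrDr mulrDl dh mulrA IHn -!mulrA IHn.
have [|l l_lim] := geometric_steps_cvg (c := r) r_ge0 r_lt1 (u := u).
  elim=> [|n IHn]; first by rewrite /u /= subr0 expr0 mulr1 g_norm // rnorm0.
  rewrite exprS; apply: (le_trans (g_lip _ _ (u_norm n.+1) (u_norm n))).
  by rewrite ler_wpM2l.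
have l_norm : rnorm l <= r.
  apply/ler_addgt0Pr => eps /l_lim[N /(_ N (leqnn N)) uN].
  have := rnormB (u N) (u N - l); rewrite opprB addrC subrK.
  have := u_norm N; lra.
have l_sa : star l = l.
  apply/eqP; rewrite -subr_eq0; apply/eqP; apply: (@rnorm_small_eq0 _ 2) => eps.
  move=> /l_lim[N /(_ N (leqnn N)) uN].
  have -> : star l - l = (u N - l) - star (u N - l).
    by rewrite starB u_sa; ncring.
  by have := rnormB (u N - l) (star (u N - l)); rewrite rnorm_star; lra.
have l_comm d : d * h = h * d -> d * l = l * d.
  move=> dh; apply/eqP; rewrite -subr_eq0; apply/eqP.
  apply: (@rnorm_small_eq0 _ (2 * rnorm d)) => eps.
  move=> /l_lim[N /(_ N (leqnn N)) uN].
  have -> : d * l - l * d = (u N - l) * d - d * (u N - l).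
    by rewrite mulrBl mulrBr (u_comm N d dh); ncring.
  have := rnormB ((u N - l) * d) (d * (u N - l)).
  have := rnormM (u N - l) d; have := rnormM d (u N - l).
  have := ler_wpM2l (rnorm_ge0 d) (ltW uN); lra.
have l_fix : l = g l.
  apply/eqP; rewrite -subr_eq0; apply/eqP; apply: (@rnorm_small_eq0 _ 2) => eps.
  move=> /l_lim[N uN].
  have -> : l - g l = (u N.+1 - g l) - (u N.+1 - l) by ncring.
  have := rnormB (u N.+1 - g l) (u N.+1 - l).
  have := g_lip _ _ (u_norm N) l_norm; rewrite -[g (u N)]/(u N.+1).
  have := uN _ (leqnSn N); have := uN _ (leqnn N).
  have := ler_wpM2r (rnorm_ge0 (u N - l)) (ltW r_lt1); lra.
exists (1 - l); split.
- by rewrite starB star1 l_sa.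
- have l2 : l + l = h + l * l.
    have half2 : 2^-1 + 2^-1 = 1 :> R by lra.
    by rewrite {1 2}l_fix -mulrDl -rscalD half2 rscal1 mul1r.
  have -> : (1 - l) * (1 - l) = 1 - (l + l) + l * l by ncring.
  by rewrite l2; ncring.
- by move=> d dh; rewrite mulrBr mulrBl mulr1 mul1r l_comm.
Qed.

(** Apply [sqrt_one_sub] to [h / t] and rescale by [Num.sqrt t]. *)
Lemma sqrt_scal_sub t h : star h = h -> rnorm h < t ->
  exists e, [/\ star e = e, e * e = rscal A t - h &
                forall d, d * h = h * d -> d * e = e * d].
Proof.
move=> h_sa h_lt; have t_gt0 : 0 < t := le_lt_trans (rnorm_ge0 h) h_lt.
have [|| e [e_sa ee e_comm]] := @sqrt_one_sub (rscal A t^-1 * h).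
- by rewrite starM star_rscal h_sa rscalC.
- rewrite rnorm_rscalM ger0_norm ?invr_ge0 ?ltW //.
  by rewrite mulrC ltr_pdivrMr // mul1r.
exists (rscal A (Num.sqrt t) * e); split.
- by rewrite starM star_rscal e_sa rscalC.
- rewrite {2}rscalC mulrA -(mulrA _ e e) ee -rscalC mulrA -rscalM -expr2.
  rewrite sqr_sqrtr ?ltW // mulrBr mulr1 mulrA -rscalM divff ?gt_eqF //.
  by rewrite rscal1 mul1r.
- move=> d dh; rewrite mulrA -rscalC -!mulrA; congr (_ * _); apply: e_comm.
  by rewrite mulrA -rscalC -!mulrA dh.
Qed.

Definition imag : A := ('i%R : R[i])%:A.

Lemma imagC a : imag * a = a * imag.
Proof. by rewrite /imag -scalerAl -scalerAr mul1r mulr1. Qed.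

Lemma imag_sq : imag * imag = -1.
Proof. by rewrite /imag -scalerAl mul1r scalerA -expr2 sqrCi scaleN1r. Qed.

Lemma star_imag : star imag = - imag.
Proof. by rewrite /imag starZ star1 conjCi scaleNr. Qed.

Lemma rnorm_imagM a : rnorm (imag * a) = rnorm a.
Proof. by rewrite /imag -scalerAl mul1r rnormZ normCi mul1r. Qed.

Lemma star_cartesian d e : star d = d -> star e = e ->
  star (d + imag * e) = d - imag * e.
Proof.
by move=> d_sa e_sa; rewrite starD starM d_sa e_sa star_imag mulrN imagC.
Qed.

(** As [d] and [e] commute, the cross terms of [star u * u] cancel for [u = d + imag * e]. *)
Lemma rnorm_cartesian d e : star d = d -> star e = e -> d * e = e * d ->
  rnorm (d * d + e * e) = rnorm (d + imag * e) ^+ 2.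
Proof.
move=> d_sa e_sa de; rewrite -rnorm_starM star_cartesian //; congr rnorm.
have -> : (d - imag * e) * (d + imag * e) = d * d - (imag * e) * (imag * e).
  by rewrite mulrBl !mulrDr (mulrA d imag e) -(imagC d) -!mulrA de; ncring.
rewrite -mulrA (mulrA e imag e) -imagC !mulrA imag_sq.
by rewrite mulN1r mulNr opprK.
Qed.

Lemma rscal2M a : rscal A 2 * a = a + a.
Proof. by rewrite (_ : 2 = 1 + 1) // rscalD rscal1 mulrDl mul1r. Qed.

(* [d] is the real part of [d + 'i *: e], whose square norm is [t]. *)
Lemma rnorm_sq_summand t d e : star d = d -> star e = e -> d * e = e * d ->
  d * d + e * e = rscal A t -> 0 <= t -> rnorm d ^+ 2 <= t.
Proof.
move=> d_sa e_sa de dde t_ge0; set u := d + imag * e.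
have -> : t = rnorm u ^+ 2.
  by rewrite -rnorm_cartesian // dde rnorm_rscal ger0_norm.
rewrite ler_pXn2r ?nnegrE ?rnorm_ge0 //.
have d2 : rscal A 2 * d = u + star u.
  by rewrite star_cartesian // rscal2M /u; ncring.
have := rnormD u (star u); rewrite -d2 rnorm_rscalM rnorm_star ger0_norm //.
lra.
Qed.

(** The imaginary part of [u = d + imag * r] is the scalar [Num.sqrt s], so
    [Num.sqrt s <= rnorm u]. *)
Lemma rnorm_sq_scal_ge s d : star d = d -> 0 <= s ->
  s <= rnorm (d * d + rscal A s).
Proof.
move=> d_sa s_ge0; pose r := rscal A (Num.sqrt s).
have r_sa : star r = r := star_rscal _ _.
have rr : r * r = rscal A s by rewrite -rscalM -expr2 sqr_sqrtr.
rewrite -rr rnorm_cartesian //; last by rewrite /r rscalC.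
set u := d + imag * r.
have u2 : rscal A 2 * (imag * r) = u - star u.
  by rewrite star_cartesian // rscal2M /u; ncring.
have sqrt_le : Num.sqrt s <= rnorm u.
  have := rnormB u (star u); rewrite -u2 rnorm_rscalM rnorm_imagM rnorm_rscal.
  by rewrite rnorm_star !ger0_norm ?sqrtr_ge0 //; lra.
rewrite -[leLHS]sqr_sqrtr //.
by rewrite ler_pXn2r ?nnegrE ?rnorm_ge0 ?sqrtr_ge0.
Qed.

(** For [m] just above the right side, [m - s - d * d] is a square [e * e], so [d] is a summand of
    [m - s]. *)
Lemma rnorm_sq_scalD s d : star d = d -> 0 <= s ->
  rnorm (d * d) + s <= rnorm (d * d + rscal A s).
Proof.
move=> d_sa s_ge0; apply/ler_addgt0Pr => eps eps_gt0.
set m := rnorm (d * d + _) + eps.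
have [||e [e_sa ee e_comm]] := @sqrt_scal_sub m (d * d + rscal A s).
- by rewrite starD starM d_sa star_rscal.
- by rewrite ltrDl.
(* [rnorm_sq_summand] needs [0 <= m - s]. *)
have m_ge : s <= m.
  by apply: (le_trans (rnorm_sq_scal_ge d_sa s_ge0)); rewrite lerDl ltW.
rewrite -lerBrDr rnorm_sq //; apply: (@rnorm_sq_summand _ d e) => //.
- by apply: e_comm; rewrite mulrDr mulrDl rscalC mulrA.
- by rewrite ee rscalB; ncring.
- by rewrite subr_ge0.
Qed.

Lemma rnorm_scal_sub_sq t d : star d = d -> rnorm (d * d) <= t ->
  rnorm (rscal A t - d * d) <= t.
Proof.
move=> d_sa d_le; apply/ler_addgt0Pr => eps eps_gt0.
have t_ge0 : 0 <= t := le_trans (rnorm_ge0 _) d_le.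
(* Half of [eps] makes the root exist; the other half pays for returning from [t'] to [t]. *)
set t' := t + eps / 2.
have [||e [e_sa ee e_comm]] := @sqrt_scal_sub t' (d * d).
- by rewrite starM d_sa.
- by apply: (le_lt_trans d_le); rewrite ltrDl divr_gt0.
have e_le : rnorm e ^+ 2 <= t'.
  apply: (@rnorm_sq_summand _ e d) => //.
  - by rewrite e_comm // mulrA.
  - by rewrite ee subrK.
  - by rewrite addr_ge0 // ltW // divr_gt0.
have -> : rscal A t - d * d = e * e - rscal A (eps / 2).
  by rewrite ee /t' rscalD; ncring.
apply: (le_trans (rnormB _ _)); rewrite rnorm_sq // rnorm_rscal.
have eps2 : 0 <= eps / 2 by lra.
by rewrite ger0_norm //; move: e_le; rewrite /t'; lra.
Qed.

(* A norm-only description of the elements with nonnegative spectrum. *)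
Definition positive a :=
  star a = a /\ exists t, rnorm (rscal A t - a) <= t.

(** The witness of [positive] can be raised, by the triangle inequality. *)
Lemma positive_large a s : positive a ->
  exists2 t, s <= t & rnorm (rscal A t - a) <= t.
Proof.
move=> [_ [t t_le]]; exists (Num.max s t); first by rewrite le_max lexx.
have [//|st] := lerP s t.
have -> : rscal A s - a = rscal A (s - t) + (rscal A t - a).
  by rewrite rscalB; ncring.
apply: (le_trans (rnormD _ _)).
by rewrite rnorm_rscal ger0_norm; lra.
Qed.

Lemma positiveD a b : positive a -> positive b -> positive (a + b).
Proof.
move=> [a_sa [s s_le]] [b_sa [t t_le]]; split; first by rewrite starD a_sa b_sa.
exists (s + t); rewrite rscalD opprD addrACA.
exact: le_trans (rnormD _ _) (lerD s_le t_le).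
Qed.

Lemma positiveZ s a : 0 <= s -> positive a -> positive (rscal A s * a).
Proof.
move=> s_ge0 [a_sa [t t_le]]; split.
  by rewrite starM star_rscal a_sa rscalC.
exists (s * t); rewrite rscalM -mulrBr rnorm_rscalM ger0_norm //.
by rewrite ler_wpM2l.
Qed.

Lemma positive_sq d : star d = d -> positive (d * d).
Proof.
move=> d_sa; split; first by rewrite starM d_sa.
by exists (rnorm (d * d)); exact: rnorm_scal_sub_sq.
Qed.

(** For a witness [s >= m], [s - a = e * e + (s - m)] has norm at most [s], and by [rnorm_sq_scalD]
    the shift adds [s - m] to the norm of [e * e]. *)
Lemma positive_sqrt_le m a e : positive a -> star e = e ->
  e * e = rscal A m - a -> rnorm (e * e) <= m.
Proof.
move=> a_pos e_sa ee; have [s s_ge s_le] := positive_large m a_pos.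
have ems : rscal A s - a = e * e + rscal A (s - m).
  by rewrite ee rscalB; ncring.
have := rnorm_sq_scalD e_sa (_ : 0 <= s - m).
by rewrite -ems subr_ge0 => /(_ s_ge); lra.
Qed.

Lemma rnorm_scal_sub_positive t a : positive a -> rnorm a < t ->
  rnorm (rscal A t - a) <= t.
Proof.
move=> a_pos a_lt; have [e [e_sa ee _]] := sqrt_scal_sub a_pos.1 a_lt.
by rewrite -ee (positive_sqrt_le a_pos).
Qed.

(** Extends [rnorm_sq_scalD] without a root of [a]: write [a] as [(m - s) - e * e] with
    [rnorm (e * e) <= m - s]. *)
Lemma rnorm_positive_scalD s a : positive a -> 0 <= s ->
  rnorm a + s <= rnorm (a + rscal A s).
Proof.
move=> a_pos s_ge0; apply/ler_addgt0Pr => eps eps_gt0.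
set m := rnorm (a + _) + eps.
have [||e [e_sa ee _]] := @sqrt_scal_sub m (a + rscal A s).
- by rewrite starD a_pos.1 star_rscal.
- by rewrite ltrDl.
have ee' : e * e = rscal A (m - s) - a by rewrite ee rscalB; ncring.
have a_eq : a = rscal A (m - s) - e * e by rewrite ee'; ncring.
rewrite -lerBrDr {1}a_eq; apply: rnorm_scal_sub_sq => //.
exact: positive_sqrt_le ee'.
Qed.

End SquareRootsAndPositivity.

(** * Positivity of [star c * c] *)

Section Kaplansky.
Context (R : realType) (A : cstarAlg R).
Implicit Types (a b c d e h k p q u v w x y : A) (s t : R).

(* Kaplansky's argument, made quantitative: [x * star x + 1] is positive because
   [x * star x + star x * x] is a sum of two squares. *)
Lemma rnorm_le_of_positive_one_sub x :
  positive (1 - star x * x) -> rnorm x ^+ 2 <= 7.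
Proof.
set k := 1 - _ => k_pos; set r := rnorm x ^+ 2; set q := x * star x.
have q_norm : rnorm q = r by rewrite rnorm_Mstar.
have q_sa : star q = q by rewrite starM starK.
have q1_pos : positive (q + 1).
  (* Up to sign, twice the real and imaginary parts of [x]: [u * u + v * v] is
     [2 * (q + star x * x)]. *)
  set u := x + star x; set v := imag A * (x - star x).
  have u_sa : star u = u by rewrite starD starK addrC.
  have v_sa : star v = v.
    by rewrite starM star_imag mulrN -imagC starB starK -mulrN opprB.
  have -> : q + 1 = rscal A 2^-1 * (u * u + v * v) + k.
    have -> : v * v = - ((x - star x) * (x - star x)).
      rewrite /v -mulrA (mulrA (x - _)) -imagC !mulrA imag_sq.
      by rewrite mulN1r mulNr.
    have -> : u * u - (x - star x) * (x - star x) =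
        rscal A 2 * (q + star x * x) by rewrite rscal2M /u /q; ncring.
    rewrite mulrA -rscalM mulVf ?pnatr_eq0 // rscal1 mul1r /k; ncring.
  apply: positiveD => //; apply: positiveZ; first by rewrite invr_ge0.
  by apply: positiveD; exact: positive_sq.
rewrite leNgt; apply/negP => r_gt7.
(* Then [rnorm k <= 1 + r < t + 1]. *)
pose t := r + 1.
have k_norm : rnorm (rscal A (t + 1) - k) <= t + 1.
  apply: rnorm_scal_sub_positive => //.
  have := rnormB (1 : A) (star x * x).
  rewrite rnorm1 rnorm_starM -/r -/k /t; lra.
(* Positivity of [k] improves the crude bound [r * (r + t)]. *)
have qt_norm : rnorm (q * (q + rscal A t)) <= r * (t + 1).
  have -> : q * (q + rscal A t) = x * (rscal A (t + 1) - k) * star x.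
    have -> : x * (rscal A (t + 1) - k) * star x =
        q * q + x * rscal A t * star x.
      by rewrite rscalD rscal1 /k /q; ncring.
    by rewrite -mulrA rscalC mulrA -mulrDr.
  apply: (le_trans (rnormM _ _)); rewrite rnorm_star.
  apply: (le_trans (ler_wpM2r (rnorm_ge0 x) (rnormM _ _))).
  by rewrite mulrAC -expr2 -/r ler_wpM2l // sqr_ge0.
(* Completing the square in [q * (q + t)]. *)
set c := q + rscal A (t / 2).
have c_sa : star c = c by rewrite starD star_rscal q_sa.
have c_norm : rnorm c ^+ 2 <= r * (t + 1) + (t / 2) ^+ 2.
  rewrite -rnorm_sq //.
  have -> : c * c = q * (q + rscal A t) + rscal A ((t / 2) ^+ 2).
    have -> : rscal A t = rscal A (t / 2) + rscal A (t / 2).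
      by rewrite -rscalD; congr rscal; lra.
    have := rscalC (t / 2) q; rewrite /c expr2 (rscalM _ (t / 2)).
    move: (rscal A (t / 2)) => m mq.
    have -> : (q + m) * (q + m) = q * q + q * m + m * q + m * m by ncring.
    by rewrite mq; ncring.
  apply: (le_trans (rnormD _ _)); rewrite rnorm_rscal ger0_norm ?sqr_ge0 //.
  by rewrite lerD2r.
(* The loss of [2] comes from writing [c] as [(q + 1) + (t / 2 - 1)] and from
   [rnorm (q + 1) >= r - 1]. *)
have c_ge : r + t / 2 - 2 <= rnorm c.
  have s_ge0 : 0 <= t / 2 - 1 by rewrite /t; lra.
  have := rnorm_positive_scalD q1_pos s_ge0.
  have -> : q + 1 + rscal A (t / 2 - 1) = c by rewrite rscalB rscal1 /c; ncring.
  have := rnormB (q + 1) (1 : A); rewrite addrK rnorm1 q_norm; lra.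
have r2_gt0 : 0 <= r + t / 2 - 2 by rewrite /t; lra.
have : (r + t / 2 - 2) ^+ 2 <= rnorm c ^+ 2.
  by rewrite ler_pXn2r ?nnegrE ?rnorm_ge0.
(* The two bounds give [r ^+ 2 - 7 * r + 2 <= 0], impossible for [r > 7]. *)
move: c_norm; rewrite /t; nra.
Qed.

(* The sequence [rnorm (w ^+ n)] is log-convex. *)
Lemma rnormXS_ge w n : star w = w ->
  rnorm w * rnorm (w ^+ n) <= rnorm (w ^+ n.+1).
Proof.
move=> w_sa; have wX_sa m : star (w ^+ m) = w ^+ m by rewrite starX w_sa.
elim: n => [|n IHn]; first by rewrite expr0 expr1 rnorm1 mulr1.
have [->|wn_neq0] := eqVneq (rnorm (w ^+ n.+1)) 0.
  by rewrite mulr0 rnorm_ge0.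
have wn_gt0 : 0 < rnorm (w ^+ n.+1) by rewrite lt_def wn_neq0 rnorm_ge0.
have : rnorm (w ^+ n.+1) ^+ 2 <= rnorm (w ^+ n.+2) * rnorm (w ^+ n).
  by rewrite -rnorm_sq // -exprD addnS -addSn exprD rnormM.
move=> /(ler_wpM2l (rnorm_ge0 w)) cvx.
rewrite -(ler_pM2r wn_gt0).
by have := ler_wpM2l (rnorm_ge0 (w ^+ n.+2)) IHn; move: cvx; lra.
Qed.

(** If [r > 1], Bernoulli's bound makes the increments, at least [(r - 1) * f n], exceed [t] once
    [n * (r - 1) ^+ 2 > t]. *)
Lemma geometric_growth_le1 (f : nat -> R) (r t : R) : f 0%N = 1 ->
    (forall n, r * f n <= f n.+1) -> (forall n, f n.+1 <= f n + t) ->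
  r <= 1.
Proof.
move=> f0 f_geo f_lin; rewrite leNgt; apply/negP => r_gt1.
have f_ge n : 1 + n%:R * (r - 1) <= f n.
  elim: n => [|n IHn]; first by rewrite mul0r addr0 f0.
  apply: le_trans (f_geo n); rewrite -natr1.
  have : 0 <= n%:R * (r - 1) by rewrite mulr_ge0 // subr_ge0 ltW.
  nra.
have r1_gt0 : 0 < r - 1 by rewrite subr_gt0.
pose n := Num.bound `|t / (r - 1) ^+ 2|.
have : t / (r - 1) ^+ 2 < n%:R.
  exact: le_lt_trans (ler_norm _) (archi_boundP (normr_ge0 _)).
rewrite ltr_pdivrMr ?exprn_gt0 // => n_gt.
have := f_ge n; have := f_geo n; have := f_lin n; nra.
Qed.

Lemma rnorm_one_sub_starM c : rnorm c < 1 -> rnorm (1 - star c * c) <= 1.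
Proof.
move=> c_lt1; set h := star c * c.
have h_sa : star h = h by rewrite starM starK.
have [|e [e_sa ee _]] := sqrt_one_sub h_sa.
  by rewrite rnorm_starM expr_lt1 // rnorm_ge0.
rewrite -/h -ee; set w := e * e.
have w_sa : star w = w by rewrite starM e_sa.
have we : w * e = e * w by rewrite mulrA.
have eX_sa n : star (e ^+ n) = e ^+ n by rewrite starX e_sa.
have wX n : w ^+ n = e ^+ n * e ^+ n by rewrite exprMn_comm.
(* Each step of the induction adds the square of [e ^+ n * (w - 1)]. *)
have pos n : positive (1 - (w ^+ n - w ^+ n.+1)).
  elim: n => [|n IHn].
    by rewrite expr0 expr1 opprB addrC subrK; exact: positive_sq.
  have -> : 1 - (w ^+ n.+1 - w ^+ n.+2) =
      1 - (w ^+ n - w ^+ n.+1) + (e ^+ n * (w - 1)) * (e ^+ n * (w - 1)).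
    have -> : (e ^+ n * (w - 1)) * (e ^+ n * (w - 1)) =
        w ^+ n * ((w - 1) * (w - 1)).
      rewrite wX -!mulrA; congr (_ * _); rewrite !mulrA; congr (_ * _).
      by apply/commrX/commr_sym/commrB; [rewrite /GRing.comm mulrA|exact: commr1].
    by rewrite !exprSr; ncring.
  apply: positiveD => //; apply: positive_sq.
  rewrite starM starB star1 w_sa eX_sa.
  by apply/commr_sym/commrB; [apply/commr_sym/commrX|exact: commr1].
apply: (@geometric_growth_le1 (fun n => rnorm (w ^+ n)) _ 7).
- by rewrite expr0 rnorm1.
- by move=> n; exact: rnormXS_ge.
move=> n; pose x := c * e ^+ n.
have xx : star x * x = w ^+ n - w ^+ n.+1.
  have -> : star x * x = e ^+ n * h * e ^+ n by rewrite starM eX_sa /h !mulrA.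
  have -> : h = 1 - w by rewrite /w ee; ncring.
  rewrite mulrBr mulrBl mulr1 -wX; congr (_ - _).
  rewrite exprSr wX -(mulrA _ w) -(mulrA _ _ w); congr (_ * _).
  exact: commrX.
have := rnorm_le_of_positive_one_sub (x := x).
rewrite xx -rnorm_starM xx => /(_ (pos n)) wn_le.
have -> : w ^+ n.+1 = w ^+ n - (w ^+ n - w ^+ n.+1).
  by rewrite opprB addrC subrK.
by apply: (le_trans (rnormB _ _)); rewrite lerD2l.
Qed.

(** Dividing [c] by [m = rnorm c + 1] brings it into the open unit ball, where [1] is a witness;
    scaling back gives [m ^+ 2]. *)
Lemma positive_starM c : positive (star c * c).
Proof.
split; first by rewrite starM starK.
set m := rnorm c + 1.
have m_gt0 : 0 < m by rewrite ltr_wpDl // rnorm_ge0.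
have := @rnorm_one_sub_starM (rscal A m^-1 * c).
rewrite rnorm_rscalM ger0_norm ?invr_ge0 ?(ltW m_gt0) //.
rewrite mulrC ltr_pdivrMr // mul1r ltrDl ltr01 => /(_ isT) c_le.
exists (m ^+ 2); rewrite -[leRHS]mulr1.
have -> : rscal A (m ^+ 2) - star c * c = rscal A (m ^+ 2) *
    (1 - star (rscal A m^-1 * c) * (rscal A m^-1 * c)).
  have -> : star (rscal A m^-1 * c) * (rscal A m^-1 * c) =
      rscal A (m^-1 * m^-1) * (star c * c).
    rewrite starM star_rscal -rscalC rscalM -!mulrA; congr (_ * _).
    by rewrite mulrA -rscalC -mulrA.
  rewrite mulrBr mulr1 (mulrA (rscal A (m ^+ 2))) -rscalM.
  rewrite -invfM -expr2 divff ?rscal1 ?mul1r //.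
  by rewrite expf_neq0 // gt_eqF.
rewrite rnorm_rscalM ger0_norm ?sqr_ge0 //.
by rewrite ler_wpM2l // sqr_ge0.
Qed.

End Kaplansky.

(** * States, Cauchy-Schwarz and the numerical radius *)

Section States.
Context (R : realType) (A : cstarAlg R).
Implicit Types (a b c d e h k p q u v w x y : A) (s t : R).

(** Abstracts the real part of a state; [numradius_le] recovers the modulus by a phase. *)
Definition real_state (f : A -> R) :=
  [/\ {morph f : a b / a + b}, forall t a, f (rscal A t * a) = t * f a,
      f 1 = 1 & forall a, f a <= rnorm a].

Section RealState.
Context (f : A -> R) (f_state : real_state f).

Let fD : {morph f : a b / a + b}. Proof. by case: f_state. Qed.
Let fZ t a : f (rscal A t * a) = t * f a. Proof. by case: f_state. Qed.
Let f1 : f 1 = 1. Proof. by case: f_state. Qed.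
Let f_le a : f a <= rnorm a. Proof. by case: f_state. Qed.

Let fN a : f (- a) = - f a.
Proof. by rewrite -[- a]mul1r mulrN -mulNr -(rscal1 A) -rscalN fZ mulN1r. Qed.

Let fB a b : f (a - b) = f a - f b.
Proof. by rewrite fD fN. Qed.

Let f_rscal t : f (rscal A t) = t.
Proof. by rewrite -[rscal A t]mulr1 fZ f1 mulr1. Qed.

(** For a witness [t], [t - f (star c * c) = f (t - star c * c) <= t]. *)
Lemma real_state_starM_ge0 c : 0 <= f (star c * c).
Proof.
have [_ [t t_le]] := positive_starM c.
have := le_trans (f_le _) t_le; rewrite fB f_rscal; lra.
Qed.

(* Compare [f (t + 'i *: h)] with its norm, [Num.sqrt (t ^+ 2 + rnorm h ^+ 2)],
   for large [t]. *)
Let f_imag_le0 h : star h = h -> f (imag A * h) <= 0.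
Proof.
move=> h_sa; set c := f _; rewrite leNgt; apply/negP => c_gt0.
pose t := rnorm h ^+ 2 / c.
have ct : c * t = rnorm h ^+ 2 by rewrite mulrC divfK // gt_eqF.
have t_ge0 : 0 <= t by rewrite divr_ge0 ?sqr_ge0 // ltW.
have : (c + t) ^+ 2 <= t ^+ 2 + rnorm h ^+ 2.
  apply: (@le_trans _ _ (rnorm (rscal A t + imag A * h) ^+ 2)).
    rewrite ler_pXn2r ?nnegrE ?rnorm_ge0 ?addr_ge0 // ?(ltW c_gt0) //.
    by apply: le_trans (f_le _); rewrite fD f_rscal addrC.
  rewrite -rnorm_cartesian ?star_rscal ?rscalC //.
  apply: (le_trans (rnormD _ _)); rewrite !rnorm_sq ?star_rscal //.
  by rewrite rnorm_rscal ger0_norm.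
rewrite -ct; have := mulr_ge0 (ltW c_gt0) t_ge0; nra.
Qed.

(** [star a - a] is [imag] times a self-adjoint element; [f_imag_le0] for that element and its
    opposite makes [f] vanish there. *)
Lemma real_state_star a : f (star a) = f a.
Proof.
have f_imag h : star h = h -> f (imag A * h) = 0.
  move=> h_sa; apply/eqP; rewrite eq_le f_imag_le0 //=.
  by rewrite -oppr_le0 -fN -mulrN f_imag_le0 // starN h_sa.
apply/eqP; rewrite -subr_eq0 -fB; apply/eqP.
have -> : star a - a = imag A * (imag A * (a - star a)).
  by rewrite mulrA imag_sq mulN1r opprB.
by rewrite f_imag // starM star_imag mulrN -imagC starB starK -mulrN opprB.
Qed.

(** Expand [f (star c * c) >= 0]. Keeping the weights [s] and [t] lets two instances be added before
    optimizing. *)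
Lemma real_state_CauchySchwarz s t u v :
  2 * (s * t * f (u * v)) <= s ^+ 2 * f (u * star u) + t ^+ 2 * f (star v * v).
Proof.
pose c := rscal A s * star u - rscal A t * v.
have := real_state_starM_ge0 c.
have -> : star c * c = rscal A (s * s) * (u * star u)
    - rscal A (s * t) * (u * v + star (u * v)) + rscal A (t * t) * (star v * v).
  have sC a : a * rscal A s = rscal A s * a by rewrite rscalC.
  have tC a : a * rscal A t = rscal A t * a by rewrite rscalC.
  rewrite /c starB (starM _ (star u)) (starM _ v) starK !star_rscal !rscalM sC tC.
  move: (rscal A s) (rscal A t) sC tC => m n mC nC.
  have -> : (m * u - n * star v) * (m * star u - n * v) =
      m * (u * m) * star u - m * (u * n) * v
      - n * (star v * m) * star u + n * (star v * n) * v by ncring.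
  rewrite (mC u) (nC u) (mC (star v)) (nC (star v)) (mulrA n m) -(nC m).
  by rewrite starM; ncring.
by rewrite fD fB !fZ fD real_state_star -!expr2; lra.
Qed.

Lemma real_state_anticommutator_le a b x y :
  f (a * x * b + b * y * a) <=
  Num.sqrt 2 * (rnorm b * Num.sqrt (rnorm (star a * a + a * star a)))
  * Num.max (rnorm x) (rnorm y).
Proof.
set k := rnorm (_ + _); set m := Num.max _ _; set l := f _.
have k_ge0 : 0 <= k := rnorm_ge0 _.
have m_ge0 : 0 <= m by rewrite le_max rnorm_ge0.
pose s := rnorm b * m.
have s_ge0 : 0 <= s by rewrite mulr_ge0 ?rnorm_ge0.
(* The weight [t] goes to [a] in both products, so [f (a * star a)] and [f (star a * a)] add up to
   at most [k]. *)
have l_quad t : 2 * (t * l) <= t ^+ 2 * k + 2 * s ^+ 2.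
  have := real_state_CauchySchwarz t 1 a (x * b).
  have := real_state_CauchySchwarz 1 t (b * y) a.
  have : f (star (x * b) * (x * b)) <= s ^+ 2.
    apply: (le_trans (f_le _)); rewrite rnorm_starM.
    rewrite ler_pXn2r ?nnegrE ?rnorm_ge0 // (le_trans (rnormM _ _)) //.
    by rewrite mulrC ler_wpM2l ?rnorm_ge0 // le_max lexx.
  have : f ((b * y) * star (b * y)) <= s ^+ 2.
    apply: (le_trans (f_le _)); rewrite rnorm_Mstar.
    rewrite ler_pXn2r ?nnegrE ?rnorm_ge0 // (le_trans (rnormM _ _)) //.
    by rewrite ler_wpM2l ?rnorm_ge0 // le_max lexx orbT.
  have : t ^+ 2 * f (star a * a + a * star a) <= t ^+ 2 * k.
    by rewrite ler_wpM2l ?sqr_ge0.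
  rewrite fD /l fD -!mulrA !mul1r; lra.
have rhs : (Num.sqrt 2 * (rnorm b * Num.sqrt k) * m) ^+ 2 = 2 * s ^+ 2 * k.
  by rewrite !exprMn !sqr_sqrtr // /s; ring.
have rhs_ge0 : 0 <= Num.sqrt 2 * (rnorm b * Num.sqrt k) * m.
  by rewrite !mulr_ge0 ?sqrtr_ge0 ?rnorm_ge0.
have [l_le0|l_gt0] := lerP l 0; first exact: le_trans rhs_ge0.
rewrite -(ler_pXn2r (n := 2)) ?nnegrE ?(ltW l_gt0) // rhs.
have [k0|k_neq0] := eqVneq k 0.
  (* This [t] would give [2 * (s ^+ 2 + 1) <= 2 * s ^+ 2]. *)
  have := l_quad ((s ^+ 2 + 1) / l); rewrite divfK ?gt_eqF // k0; lra.
(* [t = l / k] is the optimal weight. *)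
have /(ler_wpM2r k_ge0) := l_quad (l / k).
have -> : 2 * (l / k * l) * k = 2 * l ^+ 2 by field.
have -> : ((l / k) ^+ 2 * k + 2 * s ^+ 2) * k = l ^+ 2 + 2 * s ^+ 2 * k.
  by field.
lra.
Qed.

End RealState.

Lemma state_rnorm_le (f : {linear A -> R[i]^o}) a :
  states A f -> rnorm (f a) <= rnorm a.
Proof.
case=> _ _ f_norm.
(* Otherwise [sup] would take its default value [0], not [1]. *)
have f_sup : has_sup [set rnorm (f x) | x in [set x : A | rnorm x <= 1]].
  apply: contrapT => /sup_out f_norm0.
  by move: f_norm; rewrite /opnorm f_norm0 => /eqP; rewrite eq_sym oner_eq0.
have [a0|a_neq0] := eqVneq (rnorm a) 0.
  by rewrite (rnorm0_eq0 a0) linear0 !rnorm0.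
have a_gt0 : 0 < rnorm a by rewrite lt_def a_neq0 rnorm_ge0.
set b := ((rnorm a)^-1)%:C%C *: a.
have b_le1 : rnorm b <= 1.
  rewrite /b -rscalE rnorm_rscalM ger0_norm ?invr_ge0 ?rnorm_ge0 //.
  by rewrite mulVf.
have : rnorm (f b) <= 1.
  by rewrite -f_norm; apply: ub_le_sup; [exact: f_sup.2|exists b].
rewrite /b linearZ rnormZ normc_def /= expr0n addr0 sqrtr_sqr.
by rewrite ger0_norm ?invr_ge0 ?rnorm_ge0 // mulrC ler_pdivrMr // mul1r.
Qed.

Lemma real_state_Re (f : {linear A -> R[i]^o}) :
  states A f -> real_state (fun a => complex.Re (f a)).
Proof.
move=> f_state; split.
- by move=> a b; rewrite linearD raddfD.
- move=> t a; rewrite rscalE linearZ /=.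
  by case: (f a) => p q; rewrite /= mul0r subr0.
- by case: f_state => _ -> _.
- move=> a; apply: le_trans (state_rnorm_le _ f_state).
  rewrite /rnorm normc_def /=; apply: (le_trans (ler_norm _)).
  by rewrite -sqrtr_sqr ler_wsqrtr // lerDl sqr_ge0.
Qed.

Lemma numradius_le a t : 0 <= t ->
    (forall f : {linear A -> R[i]^o}, real_state (fun b => complex.Re (f b)) ->
     forall z : R[i], `|z| = 1 -> complex.Re (f (z *: a)) <= t) ->
  numradius a <= t.
Proof.
move=> t_ge0 a_le; rewrite /numradius; set V := [set _ | _ in _].
(* Without states the supremum is [0], whence the hypothesis [0 <= t]. *)
have [V0|/set0P V_neq0] := eqVneq V set0; first by rewrite V0 sup0.
apply: ge_sup => // _ [f f_state <-].
have [fa0|fa_neq0] := eqVneq (f a) 0; first by rewrite fa0 rnorm0.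
have fa_norm0 : `|f a| != 0 by rewrite normr_eq0.
(* The phase rotating [f a] onto the positive axis. *)
pose z := (f a)^* / `|f a|.
have z_norm : `|z| = 1 by rewrite normrM normfV norm_conjC normr_id divff.
have := a_le f (real_state_Re f_state) z z_norm.
have -> : f (z *: a) = `|f a|.
  rewrite linearZ -[LHS]/(z * f a) /z mulrAC (mulrC _ (f a)).
  by rewrite -normCK expr2 mulfK.
by [].
Qed.

Lemma numradius_anticommutator_le a b x y :
  numradius (a * x * b + b * y * a) <=
  Num.sqrt 2 * (rnorm b * Num.sqrt (rnorm (star a * a + a * star a)))
  * Num.max (rnorm x) (rnorm y).
Proof.
apply: numradius_le => [|f f_state z z_norm].
  by rewrite !mulr_ge0 ?sqrtr_ge0 ?rnorm_ge0 // le_max rnorm_ge0.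
have z_rnorm c : rnorm (z *: c) = rnorm c by rewrite rnormZ z_norm mul1r.
have := real_state_anticommutator_le f_state a b (z *: x) (z *: y).
by rewrite -!scalerAr -!scalerAl -scalerDr !z_rnorm.
Qed.

Lemma numradius_anticommutator_le_min a b x y :
  numradius (a * x * b + b * y * a) <=
  Num.sqrt 2
  * Num.min (rnorm b * Num.sqrt (rnorm (star a * a + a * star a)))
            (rnorm a * Num.sqrt (rnorm (star b * b + b * star b)))
  * Num.max (rnorm x) (rnorm y).
Proof.
rewrite minEle; case: ifP => _; first exact: numradius_anticommutator_le.
(* Exchange [a] with [b] and [x] with [y]. *)
by rewrite addrC maxC; exact: numradius_anticommutator_le.
Qed.

End States.

Theorem theorem4p7 (R : realType) (A : cstarAlg R) (a b x y : A) :
  let m : R :=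
    Num.min (rnorm b * Num.sqrt (rnorm (star a * a + a * star a)))
            (rnorm a * Num.sqrt (rnorm (star b * b + b * star b))) in
  [/\ numradius (a * x * b + b * y * a)
        <= Num.sqrt 2 * m * Num.max (rnorm x) (rnorm y) /\
      numradius (a * x * b - b * y * a)
        <= Num.sqrt 2 * m * Num.max (rnorm x) (rnorm y),
      numradius (a * b + b * a) <= Num.sqrt 2 * m /\
      numradius (a * b - b * a) <= Num.sqrt 2 * m,
      numradius (a * b) <= Num.sqrt 2 * m
    & a * b = b * a -> numradius (a * b) <= 1 / Num.sqrt 2 * m].
Proof.
move=> m.
have main x' y' : numradius (a * x' * b + b * y' * a)
    <= Num.sqrt 2 * m * Num.max (rnorm x') (rnorm y').
  exact: numradius_anticommutator_le_min.
have mainN x' y' : numradius (a * x' * b - b * y' * a)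
    <= Num.sqrt 2 * m * Num.max (rnorm x') (rnorm y').
  by have := main x' (- y'); rewrite mulrN mulNr rnormN.
split.
- by split.
- have := main 1 1; have := mainN 1 1.
  by rewrite !mulr1 rnorm1 maxxx mulr1; split.
- have := main 1 0.
  by rewrite mulr1 mulr0 mul0r addr0 rnorm1 rnorm0 max_l ?mulr1.
(* With [x = y = 1/2] the two commuted halves add up to [a * b], and the bound is halved. *)
move=> ab; pose r := rscal A 2^-1.
have half_ab : a * r * b + b * r * a = a * b.
  rewrite /r -!rscalC -!mulrA -ab -mulrDl -rscalD.
  have -> : 2^-1 + 2^-1 = 1 :> R by lra.
  by rewrite rscal1 mul1r.
have sqrt2_neq0 : Num.sqrt 2 != 0 :> R by rewrite sqrtr_eq0 -ltNge.
have -> : 1 / Num.sqrt 2 * m = Num.sqrt 2 * m * 2^-1.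
  have -> : 2^-1 = (Num.sqrt 2 ^+ 2)^-1 :> R by rewrite sqr_sqrtr.
  by field.
have := main r r.
by rewrite half_ab rnorm_rscal ger0_norm ?invr_ge0 // maxxx.
Qed.
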